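(* Let $\mathbf A=(A;w)$ be a finite algebra whose only basic operation $w$ is an $n$-ary weak near-unanimity operation, and let ${\sim}$ be an Abelian congruence of $\mathbf A$ with ${\sim}\prec 1_{\mathbf A}$ in $\mathrm{Con}\,\mathbf A$ and $\mathrm{typ}({\sim},1_{\mathbf A})=\mathbf 5$. Suppose the order $\le$ on $A/{\sim}$ described below has a largest element. Then every pair of ${\sim}$-classes has a greatest lower bound with respect to $\le$, and for all $x_1,\dots,x_n\in A$, $w_{|A|}(x_1,\dots,x_n)\in[x_1]_{\sim}\wedge\dots\wedge[x_n]_{\sim}$ (meet with respect to $\le$). In particular, if ${\sim}=0_{\mathbf A}$ (i.e. $\mathbf A$ is simple) and $\le$ has a greatest element, then $\mathbf A$ has a term operation which is a semilattice operation.
   Context: An $n$-ary operation $w$ is a weak near-unanimity operation if it is idempotent and satisfies $w(x,\dots,x,y)=w(x,\dots,x,y,x)=\dots=w(y,x,\dots,x)$. Types are those of tame congruence theory. Order on $A/{\sim}$: for every $({\sim},1_{\mathbf A})$-minimal set $U$ (whose body is all of $U$), $U$ meets exactly two ${\sim}$-classes $C_1,C_2$, and the polynomial operations of $\mathbf A$ restricted to $U$ induce a two-element semilattice on $\{C_1\cap U,C_2\cap U\}$ modulo ${\sim}$; declare $C_1$ below $C_2$ if $C_1\cap U$ is the bottom of this semilattice. $\le$ is the reflexive-transitive closure of these relations over all minimal sets; it is a connected partial order on $A/{\sim}$. Define $w_1=w$; $x\circ_i y:=w_i(y,x,\dots,x)$; $w_{i+1}(x_1,\dots,x_n)=w_i(w_i(x_1,\dots,x_n)\circ_i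 x_1,\dots,w_i(x_1,\dots,x_n)\circ_i x_n)$. *)

(* Defs.v *)
From Stdlib Require Import Relation_Operators.
From mathcomp Require Import all_boot.

Set Implicit Arguments.
Unset Strict Implicit.
Unset Printing Implicit Defensive.

Inductive term (n : nat) (V : Type) : Type :=
| Var of V
| App of 'I_n -> term n V.

Section Algebra.
Variables (A : finType) (n : nat) (w : {ffun 'I_n -> A} -> A).

Fixpoint eval (V : Type) (rho : V -> A) (t : term n V) : A :=
  match t with
  | Var v => rho v
  | App s => w [ffun i => eval rho (s i)]
  end.

Definition sum_env (V1 V2 : Type) (r1 : V1 -> A) (r2 : V2 -> A)
  (v : V1 + V2) : A :=
  match v with inl v1 => r1 v1 | inr v2 => r2 v2 end.

Definition term_operation (k : nat) (f : {ffun 'I_k -> A} -> A) : Prop :=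
  exists t : term n 'I_k, forall x, f x = eval x t.

(* A polynomial is a term whose variables are either arguments or constants
   from [A]. *)
Definition polynomial (k : nat) (f : {ffun 'I_k -> A} -> A) : Prop :=
  exists t : term n ('I_k + A), forall x, f x = eval (sum_env x id) t.

Definition unary_polynomial (f : A -> A) : Prop :=
  polynomial (fun x : {ffun 'I_1 -> A} => f (x ord0)).

Definition congruence (R : rel A) : Prop :=
  equivalence_rel R /\
  forall x y : {ffun 'I_n -> A},
    (forall i, R (x i) (y i)) -> R (w x) (w y).

Definition con0 : rel A := fun x y => x == y.
Definition con1 : rel A := fun _ _ => true.

Definition con_covers (alpha beta : rel A) : Prop :=
  [/\ congruence alpha, congruence beta, subrel alpha beta,
      ~ subrel beta alpha
    & forall theta, congruence theta -> subrel alpha theta ->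
        subrel theta beta -> theta =2 alpha \/ theta =2 beta].

(* The term condition C(alpha, beta; gamma). *)
Definition centralizes (alpha beta gamma : rel A) : Prop :=
  forall (p q : nat) (t : term n ('I_p + 'I_q))
         (a b : 'I_p -> A) (c d : 'I_q -> A),
    (forall i, alpha (a i) (b i)) -> (forall j, beta (c j) (d j)) ->
    gamma (eval (sum_env a c) t) (eval (sum_env a d) t) ->
    gamma (eval (sum_env b c) t) (eval (sum_env b d) t).

Definition abelian_congruence (theta : rel A) : Prop :=
  congruence theta /\ centralizes theta theta con0.

Definition separating_image (alpha beta : rel A) (U : {set A}) : Prop :=
  exists f : A -> A,
    [/\ unary_polynomial f,
        exists x y, beta x y /\ ~~ alpha (f x) (f y)
      & U = [set f x | x : A]].

Definition minimal_set (alpha beta : rel A) (U : {set A}) : Prop :=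
  separating_image alpha beta U /\
  forall V : {set A}, separating_image alpha beta V -> V \subset U -> V = U.

Definition trace_of (alpha beta : rel A) (U N : {set A}) : Prop :=
  exists x, [/\ x \in U, N = U :&: [set y | beta x y]
    & ~~ (N \subset [set y | alpha x y])].

(* [f] is an operation of (A|_N)/(alpha|_N), where the blocks of alpha|_N are
   named by the values of [h] on [N]. *)
Definition induced_operation (N : {set A}) (h : A -> bool)
  (k : nat) (f : {ffun 'I_k -> bool} -> bool) : Prop :=
  exists p : {ffun 'I_k -> A} -> A,
    [/\ polynomial p,
        forall x : {ffun 'I_k -> A}, (forall i, x i \in N) -> p x \in N
      & forall x : {ffun 'I_k -> A}, (forall i, x i \in N) ->
          h (p x) = f [ffun i => h (x i)]].

End Algebra.

Definition meet2 (v : {ffun 'I_2 -> bool}) : bool := v ord0 && v ord_max.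

Section TameCongruence.
Variables (A : finType) (n : nat) (w : {ffun 'I_n -> A} -> A).

(* (A|_N)/(alpha|_N) is polynomially equivalent to a two-element semilattice:
   [h] induces a bijection from the blocks of alpha|_N onto [bool] carrying the
   operations of (A|_N)/(alpha|_N) onto the polynomials of ({false, true}; &&).
   The block sent to [false] is the bottom of the semilattice; [h] is unique
   on [N], since || is not a polynomial of ({false, true}; &&). *)
Definition semilattice_labelling (alpha : rel A) (N : {set A})
  (h : A -> bool) : Prop :=
  [/\ forall x y, x \in N -> y \in N -> alpha x y = (h x == h y),
      forall b, exists2 x, x \in N & h x = b
    & forall (k : nat) (f : {ffun 'I_k -> bool} -> bool),
        induced_operation w N h f <-> polynomial meet2 f].

(* typ(alpha, beta) is the common type of the algebras (A|_N)/(alpha|_N), for N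
   ranging over all (alpha, beta)-traces. *)
Definition has_type5 (alpha beta : rel A) : Prop :=
  forall U N : {set A}, minimal_set w alpha beta U ->
    trace_of alpha beta U N -> exists h, semilattice_labelling alpha N h.

Definition class_of (R : rel A) (x : A) : {set A} := [set y | R x y].
Definition classes (R : rel A) : {set {set A}} := [set class_of R x | x : A].

Definition class_below (R : rel A) (C1 C2 : {set A}) : Prop :=
  [/\ C1 \in classes R, C2 \in classes R
    & exists U h,
      [/\ minimal_set w R (@con1 A) U, semilattice_labelling R U h,
          C1 :&: U = [set x in U | ~~ h x]
        & C2 :&: U = [set x in U | h x]]].

Definition class_le (R : rel A) : {set A} -> {set A} -> Prop :=
  clos_refl_trans _ (class_below R).

Definition has_largest_class (R : rel A) : Prop :=
  exists2 T, T \in classes R & forall C, C \in classes R -> class_le R C T.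

Definition is_meet (R : rel A) (F : {set {set A}}) (M : {set A}) : Prop :=
  [/\ M \in classes R,
      forall C, C \in F -> class_le R M C
    & forall D, D \in classes R -> (forall C, C \in F -> class_le R D C) ->
        class_le R D M].

End TameCongruence.

Section WeakNearUnanimity.
Variables (A : finType) (n : nat).
Implicit Type w : {ffun 'I_n -> A} -> A.

Definition weak_near_unanimity w : Prop :=
  (forall x, w [ffun=> x] = x) /\
  forall (x y : A) (i j : 'I_n),
    w [ffun k => if k == i then y else x] =
    w [ffun k => if k == j then y else x].

Definition circ w (x y : A) : A :=
  w [ffun k : 'I_n => if val k == 0 then y else x].

Definition wnu_step w (x : {ffun 'I_n -> A}) : A :=
  w [ffun j => circ w (w x) (x j)].

(* Indexed from 1: [wnu_iter w 1] is [w]. *)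
Definition wnu_iter w (i : nat) : {ffun 'I_n -> A} -> A :=
  iter i.-1 wnu_step w.

End WeakNearUnanimity.

Definition apply2 (A : Type) (s : {ffun 'I_2 -> A} -> A) (x y : A) : A :=
  s [ffun i => if i == ord0 then x else y].

Definition semilattice_operation (A : Type) (s : A -> A -> A) : Prop :=
  [/\ idempotent_op s, commutative s & associative s].

(* Main.v *)
(** Modulo [R] the algebra is simple of type 5.  Polynomials carry a minimal
    pair [a < b] to a minimal pair with the same orientation, or collapse it
    (reversing it would turn a meet into a join), so [<=] is a compatible
    partial order.  Let [t] be a weak near-unanimity term.  If [a <= b], then
    [t (b, a, .., a) = a]: otherwise some polynomial would act as a join on a
    minimal pair.  If [a < b], then [t (a, b, .., b) < b].  Hence, with [T] the
    largest element, the values [w_i (x, T, .., T)] decrease strictly until they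
    reach [x], which happens by [i = #|A|].  By monotonicity [w_|A|] then lies
    below each of its arguments, and by idempotence it is their greatest lower
    bound. *)

From mathcomp Require Import boolp.
Require Import Defs.
From Stdlib Require Import Relation_Operators Operators_Properties.
From mathcomp Require Import all_boot.

Set Implicit Arguments.
Unset Strict Implicit.
Unset Printing Implicit Defensive.

(** * Terms and polynomials *)

Section Terms.
Variables (A : finType) (n : nat) (w : {ffun 'I_n -> A} -> A).

Fixpoint subst (V W : Type) (s : V -> term n W) (t : term n V) : term n W :=
  match t with
  | Var v => s v
  | App f => App (fun i => subst s (f i))
  end.

Lemma eval_subst (V W : Type) (s : V -> term n W) (rho : W -> A)
  (sigma : V -> A) (t : term n V) :
  (forall v, sigma v = eval w rho (s v)) ->
  eval w rho (subst s t) = eval w sigma t.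
Proof.
move=> hs; elim: t => [v|f IH] /=; first by rewrite hs.
by congr w; apply/ffunP => i; rewrite !ffunE.
Qed.

Lemma term_operation_proj k (i : 'I_k) : term_operation w (fun x => x i).
Proof. by exists (Var n i). Qed.

Lemma term_operation_comp k m (p : {ffun 'I_k -> A} -> A)
  (q : 'I_k -> {ffun 'I_m -> A} -> A) :
  term_operation w p -> (forall i, term_operation w (q i)) ->
  term_operation w (fun x => p [ffun i => q i x]).
Proof.
move=> [t ht] /fin_all_exists[s hs]; exists (subst s t) => x.
rewrite ht; apply/esym/eval_subst => i.
by rewrite ffunE hs.
Qed.

Lemma term_operation_self : term_operation w w.
Proof.
exists (App (fun i => Var n i)) => x /=; congr w.
by apply/ffunP => i; rewrite ffunE.
Qed.

Lemma polynomial_term k (p : {ffun 'I_k -> A} -> A) :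
  term_operation w p -> polynomial w p.
Proof.
move=> [t ht]; exists (subst (fun i => Var n (inl i)) t) => x.
by rewrite ht; apply/esym/eval_subst.
Qed.

Lemma polynomial_const k c : polynomial w (fun _ : {ffun 'I_k -> A} => c).
Proof. by exists (Var n (inr c)). Qed.

Lemma polynomial_proj k (i : 'I_k) : polynomial w (fun x => x i).
Proof. exact/polynomial_term/term_operation_proj. Qed.

Lemma polynomial_comp k m (p : {ffun 'I_k -> A} -> A)
  (q : 'I_k -> {ffun 'I_m -> A} -> A) :
  polynomial w p -> (forall i, polynomial w (q i)) ->
  polynomial w (fun x => p [ffun i => q i x]).
Proof.
move=> [t ht] /fin_all_exists[s hs].
exists (subst (fun v => match v with
                        | inl i => s i | inr c => Var n (inr c) end) t) => x.
rewrite ht; apply/esym/eval_subst => -[i|c] //=.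
by rewrite ffunE hs.
Qed.

Lemma polynomial_unary_comp k (f : A -> A) (p : {ffun 'I_k -> A} -> A) :
  unary_polynomial w f -> polynomial w p -> polynomial w (fun x => f (p x)).
Proof.
move=> hf hp; have [t ht] := polynomial_comp hf (fun _ => hp).
by exists t => x; rewrite -ht ffunE.
Qed.

Lemma unary_polynomial_comp (f g : A -> A) :
  unary_polynomial w f -> unary_polynomial w g ->
  unary_polynomial w (fun x => f (g x)).
Proof. exact: polynomial_unary_comp. Qed.

Lemma unary_polynomial_of k (p : {ffun 'I_k -> A} -> A) (q : 'I_k -> A -> A) :
  polynomial w p -> (forall i, unary_polynomial w (q i)) ->
  unary_polynomial w (fun x => p [ffun i => q i x]).
Proof. by move=> hp hq; apply: (polynomial_comp hp (fun i => hq i)). Qed.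

Lemma unary_polynomial_id : unary_polynomial w id.
Proof. exact: polynomial_proj. Qed.

Lemma unary_polynomial_const c : unary_polynomial w (fun=> c).
Proof. exact: polynomial_const. Qed.

(** Replacing one argument at a time turns each change into the action of a unary polynomial, and
    transitivity joins the steps. *)
Lemma preorder_compatible (P : A -> A -> Prop) :
  (forall x, P x x) -> (forall x y z, P x y -> P y z -> P x z) ->
  (forall f, unary_polynomial w f -> forall x y, P x y -> P (f x) (f y)) ->
  forall k (p : {ffun 'I_k -> A} -> A), polynomial w p ->
  forall x y : {ffun 'I_k -> A}, (forall i, P (x i) (y i)) -> P (p x) (p y).
Proof.
move=> Prefl Ptrans Punary k p hp x y hxy.
pose z m := [ffun i : 'I_k => if i < m then y i else x i].
have hz m : m <= k -> P (p x) (p (z m)).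
  elim: m => [_|m IH hm].
    by have -> : z 0 = x by apply/ffunP => i; rewrite ffunE.
  apply: Ptrans (IH (ltnW hm)) _.
  pose j := Ordinal hm.
  pose q (i : 'I_k) (s : A) := if i == j then s else z m i.
  have hq : unary_polynomial w (fun s => p [ffun i => q i s]).
    apply: unary_polynomial_of => // i; rewrite /q.
    by case: (i == j); [apply: unary_polynomial_id | apply: unary_polynomial_const].
  have := Punary _ hq _ _ (hxy j).
  suff [-> ->] : [ffun i => q i (x j)] = z m /\ [ffun i => q i (y j)] = z m.+1.
    by [].
  split; apply/ffunP => i; rewrite !ffunE /q; case: eqP => [->|/eqP hij].
  - by rewrite ltnn.
  - by rewrite ffunE.
  - by rewrite ltnSn.
  - by rewrite ffunE ltnS [i <= m]leq_eqVlt (negPf (hij : (i : nat) != m)).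
have -> : y = z k by apply/ffunP => i; rewrite ffunE ltn_ord.
exact: hz.
Qed.

Lemma congruence_polynomial (R : rel A) k (p : {ffun 'I_k -> A} -> A) :
  congruence w R -> polynomial w p ->
  forall x y : {ffun 'I_k -> A}, (forall i, R (x i) (y i)) -> R (p x) (p y).
Proof.
move=> [eqR compR] [t ht] x y hxy; rewrite !ht.
elim: t {ht} => [[i|c]|f IH] //=; first by have [-> _] := eqR c c c.
by apply: compR => i; rewrite !ffunE.
Qed.

Lemma congruence_unary (R : rel A) f : congruence w R -> unary_polynomial w f ->
  forall x y, R x y -> R (f x) (f y).
Proof.
move=> hR hf x y hxy.
have := @congruence_polynomial _ _ _ hR hf [ffun=> x] [ffun=> y].
by rewrite !ffunE; apply=> i; rewrite !ffunE.
Qed.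

End Terms.

(** Meet commutes with itself and constants are idempotent, so both preserve meets. Join and
    negation do not, which is how type 5 is exploited below. *)
Lemma meet2_polynomial_preserves k (f : {ffun 'I_k -> bool} -> bool) :
  polynomial meet2 f -> forall u v : {ffun 'I_k -> bool},
  f [ffun i => u i && v i] = f u && f v.
Proof.
move=> [t ht] u v; rewrite !ht.
elim: t {ht} => [[i|c]|s IH] /=; rewrite ?ffunE ?andbb //.
by rewrite /meet2 !ffunE !IH andbACA.
Qed.

Lemma polynomial_meet2 : polynomial meet2 meet2.
Proof. exact/polynomial_term/term_operation_self. Qed.

(** * Minimal pairs and the order they generate *)

Section Edges.
Variables (A : finType) (n : nat) (w : {ffun 'I_n -> A} -> A) (R : rel A).
Hypotheses (hcov : con_covers w R (@con1 A)) (ht5 : has_type5 w R (@con1 A)).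

Let Rcong : congruence w R. Proof. by case: hcov. Qed.

Let Rxx x : R x x.
Proof. by have [/(_ x x x)[]] := Rcong. Qed.

Let Req x y z : R x y -> R x z = R y z.
Proof. by have [/(_ x y z)[]] := Rcong. Qed.

Let Rsym x y : R x y = R y x.
Proof. by apply/idP/idP => h; [rewrite -(Req x h) | rewrite -(Req y h)]. Qed.

Let Reqr x y z : R x y -> R z x = R z y.
Proof. by move=> h; rewrite ![R z _]Rsym (Req z h). Qed.

Let Rtrans x y z : R x y -> R y z -> R x z.
Proof. by move=> h; rewrite (Req z h). Qed.

Lemma class_of_eq x y : (class_of R x == class_of R y) = R x y.
Proof.
apply/eqP/idP => [h|h]; last by apply/setP => z; rewrite !inE (Req z h).
by have := Rxx y; rewrite -[R y y](in_set (R y)) -/(class_of R y) -h inE.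
Qed.

Lemma class_of_in x : class_of R x \in classes R.
Proof. exact: imset_f. Qed.

(* The kernel of all polynomials into [U] is a congruence above [R], hence
   equals [R] as soon as one of these polynomials is not constant modulo [R]. *)
Lemma polynomial_separation (U : {set A}) f x0 y0 a b :
  unary_polynomial w f -> (forall x, f x \in U) -> ~~ R (f x0) (f y0) ->
  ~~ R a b ->
  exists q, [/\ unary_polynomial w q, forall x, q x \in U & ~~ R (q a) (q b)].
Proof.
move=> hf fU nRf nRab.
pose Q x y := forall q, unary_polynomial w q -> (forall z, q z \in U) ->
  R (q x) (q y).
pose theta : rel A := fun x y => `[< Q x y >].
have Qrefl x : Q x x by move=> q _ _; apply: Rxx.
have Qtrans x y z : Q x y -> Q y z -> Q x z.
  by move=> h1 h2 q hq qU; apply: Rtrans (h1 q hq qU) (h2 q hq qU).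
have Qsym x y : Q x y -> Q y x by move=> h q hq qU; rewrite Rsym; apply: h.
have Qunary g : unary_polynomial w g -> forall x y, Q x y -> Q (g x) (g y).
  move=> hg x y h q hq qU; apply: (h (fun z => q (g z))) => //.
  exact: unary_polynomial_comp.
have thetaC : congruence w theta.
  split=> [x y z|x y h].
    split; first exact/asboolP/Qrefl.
    move/asboolP=> h; apply/asboolP/asboolP => h'; last exact: Qtrans h h'.
    exact: Qtrans (Qsym _ _ h) h'.
  apply/asboolP; apply: (preorder_compatible Qrefl Qtrans Qunary).
    exact/polynomial_term/term_operation_self.
  by move=> i; apply/asboolP/h.
have [_ _ _ _ /(_ theta thetaC)] := hcov.
case=> [x y h|//|h|h].
- apply/asboolP => q hq _; exact: (congruence_unary Rcong hq).
- apply: contrapT => none; move/negP: nRab; apply; rewrite -h.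
  apply/asboolP => q hq qU; apply: contrapT => /negP nR.
  by apply: none; exists q.
(* The total relation is excluded by [f] itself, a polynomial into [U] that separates [x0] and
   [y0]. *)
- have /asboolP /(_ f hf fU) : theta x0 y0 by rewrite h.
  by rewrite (negPf nRf).
Qed.

(** Stated on representatives, so that polynomials of the algebra act on edges directly. *)
Definition edge a b := class_below w R (class_of R a) (class_of R b).

Lemma edge_congr a a' b b' : R a a' -> R b b' -> edge a b -> edge a' b'.
Proof.
by rewrite -!class_of_eq /edge => /eqP-> /eqP->.
Qed.

Lemma edge_nR a b : edge a b -> ~~ R a b.
Proof.
move=> [_ _ [U [h [_ [hR hsurj _] hC1 hC2]]]].
have [x xU hx] := hsurj true; have [y yU hy] := hsurj false.
have Rb : x \in class_of R b :&: U by rewrite hC2 inE xU hx.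
have Ra : y \in class_of R a :&: U by rewrite hC1 inE yU hy.
move: Ra Rb; rewrite !inE => /andP[ay _] /andP[bx _].
apply/negP => ab; have := hR _ _ xU yU; rewrite hx hy /= => /negP; apply.
by rewrite -(Req y bx) -(Req y ab).
Qed.

(** The elements [a] and [b] need not lie in [U]. A polynomial into [U] that separates them either
    fixes or swaps their two classes; in the second case its square fixes them. *)
Lemma edge_retraction a b : edge a b -> exists U h e,
  [/\ semilattice_labelling w R U h,
      forall x, x \in U -> R (if h x then b else a) x,
      unary_polynomial w e, forall x, e x \in U
    & R a (e a) /\ R b (e b)].
Proof.
move=> hab; have nRab := edge_nR hab.
have [_ _ [U [h [[sepU minU] hlab hC1 hC2]]]] := hab.
have hU x : x \in U -> R (if h x then b else a) x.
  move=> xU; case hx: (h x).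
    have : x \in class_of R b :&: U by rewrite hC2 inE xU hx.
    by rewrite !inE => /andP[].
  have : x \in class_of R a :&: U by rewrite hC1 inE xU hx.
  by rewrite !inE => /andP[].
have [f [hf [x [y [_ nRf]]] eqU]] := sepU.
have fU z : f z \in U by rewrite eqU imset_f.
have [q [hq qU nRq]] := polynomial_separation hf fU nRf nRab.
have qR c d : R c d -> R (q c) (q d) by apply: (congruence_unary Rcong hq).
case hqa: (h (q a)); last first.
  exists U, h, q; split=> //; split; first by have := hU _ (qU a); rewrite hqa.
  have := hU _ (qU b); case: (h (q b)) => // aqb; move: nRq.
  by rewrite -(Reqr _ aqb) Rsym; have := hU _ (qU a); rewrite hqa => ->.
have bqa := hU _ (qU a); rewrite hqa in bqa.
have aqb : R a (q b).
  have := hU _ (qU b); case: (h (q b)) => // bqb.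
  by move: nRq; rewrite -(Req _ bqa) bqb.
(* Here [q] swaps the two classes. *)
exists U, h, (fun z => q (q z)); split=> //; first exact: unary_polynomial_comp.
by split; [apply: Rtrans aqb (qR _ _ bqa) | apply: Rtrans bqa (qR _ _ aqb)].
Qed.

Lemma edge_separation a b c d : edge a b -> ~~ R c d -> exists q,
  [/\ unary_polynomial w q, forall x, R a (q x) || R b (q x)
    & ~~ R (q c) (q d)].
Proof.
move=> hab nRcd; have nRab := edge_nR hab.
have [U [h [e [_ hU he eU [ea eb]]]]] := edge_retraction hab.
have nRe : ~~ R (e a) (e b) by rewrite -(Req _ ea) -(Reqr _ eb).
have [q [hq qU nRq]] := polynomial_separation he eU nRe nRcd.
exists q; split=> // x.
by have := hU _ (qU x); case: ifP => _ ->; rewrite ?orbT.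
Qed.

(** Embeds the Boolean cube along [k] edges, so that a polynomial can be read as a Boolean
    operation. *)
Definition choices k (c d : 'I_k -> A) (u : {ffun 'I_k -> bool}) :=
  [ffun i => if u i then d i else c i].

(** Following [P] by the retraction gives an operation on [U], hence modulo [R] a polynomial of the
    two-element semilattice. The retraction fixes the classes of [a] and [b], so it does not change
    [P] modulo [R]. *)
Lemma edge_meet_preserving1 a b k (P : {ffun 'I_k -> A} -> A) :
  edge a b -> polynomial w P -> (forall x, R a (P x) || R b (P x)) ->
  forall u v : {ffun 'I_k -> bool},
  R b (P (choices (fun=> a) (fun=> b) [ffun i => u i && v i])) =
  R b (P (choices (fun=> a) (fun=> b) u)) &&
  R b (P (choices (fun=> a) (fun=> b) v)).
Proof.
move=> hab hP rP; have nRab := edge_nR hab.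
have [U [h [e [[_ _ hind] hU he eU [ea eb]]]]] := edge_retraction hab.
have eR := @congruence_unary _ _ _ _ _ Rcong he.
have hE z : z \in U -> h z = R b z.
  move=> /hU; case: (h z) => [->//|az].
  by rewrite -(Reqr _ az) Rsym (negPf nRab).
apply: (@meet2_polynomial_preserves _
  (fun u => R b (P (choices (fun=> a) (fun=> b) u)))).
apply/hind; exists (fun x => e (P x)); split=> [|x _|x xU] //.
  exact: polynomial_unary_comp.
rewrite hE //.
(* Each argument in [U] is replaced by whichever of [a], [b] lies in its class. *)
set y := choices _ _ _.
have Rxy : R (P x) (P y).
  apply: (congruence_polynomial Rcong hP) => i.
  by rewrite !ffunE Rsym; apply: hU.
rewrite -(Reqr b Rxy); case/orP: (rP x) => Px.
  by rewrite -(Reqr _ (eR _ _ Px)) -(Reqr _ ea) -(Reqr _ Px).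
by rewrite -(Reqr _ (eR _ _ Px)) -(Reqr _ eb) Px Rxx.
Qed.

(** The semilattice meet is induced on [U] by some polynomial; retracting its arguments into [U]
    first controls its values on all of [A]. *)
Lemma edge_meet a b : edge a b -> exists m : {ffun 'I_2 -> A} -> A,
  [/\ polynomial w m, forall x, R a (m x) || R b (m x)
    & forall u, R b (m (choices (fun=> a) (fun=> b) u)) = meet2 u].
Proof.
move=> hab; have nRab := edge_nR hab.
have [U [h [e [[_ _ hind] hU he eU [ea eb]]]]] := edge_retraction hab.
have hE z : z \in U -> h z = R b z.
  move=> /hU; case: (h z) => [->//|az].
  by rewrite -(Reqr _ az) Rsym (negPf nRab).
have [p [hp pU hph]] := (hind 2 meet2).2 polynomial_meet2.
pose z (x : {ffun 'I_2 -> A}) := [ffun i => e (x i)].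
have zU x i : z x i \in U by rewrite ffunE.
exists (fun x => p (z x)); split.
- apply: polynomial_comp => // i.
  by apply: polynomial_unary_comp => //; apply: polynomial_proj.
- by move=> x; have := hU _ (pU _ (zU x)); case: ifP => _ ->; rewrite ?orbT.
- move=> u; rewrite -hE ?hph //; try exact: pU.
  congr meet2; apply/ffunP => i; rewrite ffunE hE // !ffunE.
  case: (u i); first exact: eb.
  by rewrite -(Reqr _ ea) Rsym (negPf nRab).
Qed.

(* A polynomial exchanging the orientations of two edges would turn the meet
   of one of them into a join on the other. *)
Lemma edge_transport a b c d : edge a b -> edge c d -> exists q,
  [/\ unary_polynomial w q, R c (q a) & R d (q b)].
Proof.
move=> hab hcd; have [nRab nRcd] := (edge_nR hab, edge_nR hcd).
have [q [hq rq nRq]] := edge_separation hcd nRab.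
have qR x y : R x y -> R (q x) (q y) by apply: (congruence_unary Rcong hq).
case/orP: (rq a) => qa.
  exists q; split=> //; case/orP: (rq b) => // qb.
  by move: nRq; rewrite -(Req _ qa) qb.
have qb : R c (q b).
  by case/orP: (rq b) => // qb; move: nRq; rewrite -(Req _ qa) qb.
have [r [hr rr nRr]] := edge_separation hab nRcd.
have rR x y : R x y -> R (r x) (r y) by apply: (congruence_unary Rcong hr).
have nRdc : R d c = false by rewrite Rsym (negPf nRcd).
have nRba : R b a = false by rewrite Rsym (negPf nRab).
(* Now [q] reverses the edge. If [r] keeps the orientation, [q] after [r] swaps [c] and [d], and
   negation does not preserve meets. *)
case/orP: (rr c) => rc.
  have rd : R b (r d).
    by case/orP: (rr d) => // rd; move: nRr; rewrite -(Req _ rc) rd.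
  have hqr : polynomial w (fun x : {ffun 'I_1 -> A} => q (r (x ord0))).
    exact: unary_polynomial_comp hq hr.
  have := @edge_meet_preserving1 c d 1 _ hcd hqr (fun x => rq _).
  move/(_ [ffun=> true] [ffun=> false]).
  rewrite !ffunE /= -(Reqr _ (qR _ _ rd)) -(Reqr _ qb) nRdc.
  by rewrite -(Reqr _ (qR _ _ rc)) qa.
have rd : R a (r d).
  by case/orP: (rr d) => // rd; move: nRr; rewrite -(Req _ rc) rd.
(* If [r] reverses too, conjugating the meet on [a], [b] by [r] and [q] yields the join on [c], [d],
   by De Morgan. *)
have [m [hm rm mE]] := edge_meet hab.
pose z (x : {ffun 'I_2 -> A}) := [ffun i => r (x i)].
have hqm : polynomial w (fun x => q (m (z x))).
  apply: polynomial_unary_comp => //; apply: polynomial_comp => // i.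
  by apply: polynomial_unary_comp => //; apply: polynomial_proj.
have qmE u : R d (q (m (z (choices (fun=> c) (fun=> d) u)))) =
             ~~ meet2 [ffun i => ~~ u i].
  set y := z _; pose v := [ffun i => ~~ u i].
  have Ry : R (m y) (m (choices (fun=> a) (fun=> b) v)).
    apply: (congruence_polynomial Rcong hm) => i; rewrite !ffunE Rsym.
    by case: (u i).
  rewrite -/v -mE -(Reqr _ Ry); case/orP: (rm y) => my.
    by rewrite -(Reqr _ (qR _ _ my)) qa -(Reqr _ my) nRba.
  by rewrite -(Reqr _ (qR _ _ my)) -(Reqr _ qb) nRdc my.
have := @edge_meet_preserving1 c d 2 _ hcd hqm (fun x => rq _).
move/(_ [ffun i => i == ord0] [ffun i => i != ord0]).
by rewrite !qmE /meet2 !ffunE.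
Qed.

(** Polynomials transporting the edge from [a] to [b] onto each of the given edges reduce this to
    [edge_meet_preserving1]. *)
Lemma edge_meet_preserving a b k (c d : 'I_k -> A) (P : {ffun 'I_k -> A} -> A) :
  edge a b -> (forall i, edge (c i) (d i)) ->
  polynomial w P -> (forall x, R a (P x) || R b (P x)) ->
  forall u v : {ffun 'I_k -> bool},
  R b (P (choices c d [ffun i => u i && v i])) =
  R b (P (choices c d u)) && R b (P (choices c d v)).
Proof.
move=> hab hcd hP rP u v.
have /fin_all_exists[q hq] i := edge_transport hab (hcd i).
pose z (x : {ffun 'I_k -> A}) := [ffun i => q i (x i)].
have hPz : polynomial w (fun x => P (z x)).
  apply: polynomial_comp => // i; have [hqi _ _] := hq i.
  by apply: polynomial_unary_comp => //; apply: polynomial_proj.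
have zE t : R b (P (choices c d t)) =
            R b (P (z (choices (fun=> a) (fun=> b) t))).
  apply: Reqr; apply: (congruence_polynomial Rcong hP) => i; rewrite !ffunE.
  by have [_ ? ?] := hq i; case: (t i).
by rewrite !zE; apply: (edge_meet_preserving1 hab hPz).
Qed.

Lemma edge_monotone a b c d f : edge a b -> edge c d -> unary_polynomial w f ->
  (forall x, R a (f x) || R b (f x)) -> R b (f c) -> R b (f d).
Proof.
move=> hab hcd hf rf.
have := @edge_meet_preserving a b 1 (fun=> c) (fun=> d) _ hab (fun=> hcd) hf
  (fun x => rf _) [ffun=> true] [ffun=> false].
by rewrite !ffunE /= => -> /andP[].
Qed.

(** Since [con1] has a single block, a minimal set is its own trace, which lets [has_type5] label
    it. *)
Lemma minimal_set_trace U : minimal_set w R (@con1 A) U ->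
  trace_of R (@con1 A) U U.
Proof.
move=> [[f [_ [x [y [_ nR]]] ->]] _]; exists (f x); split.
- exact: imset_f.
- by apply/setP => z; rewrite !inE andbT.
- by apply/subsetPn; exists (f y); rewrite ?imset_f ?inE.
Qed.

(** The image of [f] after the retraction contains a minimal set, and this set meets exactly the
    classes of [f a] and [f b]. It remains to exclude the reversed orientation. *)
Lemma edge_image a b f : edge a b -> unary_polynomial w f -> ~~ R (f a) (f b) ->
  edge (f a) (f b).
Proof.
move=> hab hf nRf.
have fR x y : R x y -> R (f x) (f y) by apply: (congruence_unary Rcong hf).
have [U [h [e [_ hU he eU [ea eb]]]]] := edge_retraction hab.
have hfe := unary_polynomial_comp hf he.
have rfe x : R (f a) (f (e x)) || R (f b) (f (e x)).
  by have := hU _ (eU x); case: ifP => _ /fR->; rewrite ?orbT.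
have sepfe : separating_image w R (@con1 A) [set f (e x) | x : A].
  exists (fun x => f (e x)); split=> //; exists a, b; split=> //.
  by rewrite -(Req _ (fR _ _ ea)) -(Reqr _ (fR _ _ eb)).
have [V /minsetP[/asboolP sepV minV] subV] :=
  @minset_exists _ (fun V => `[< separating_image w R (@con1 A) V >]) _
    (introT (asboolP _) sepfe).
have mV : minimal_set w R (@con1 A) V.
  by split=> // W sW; apply: minV; apply/asboolP.
have rV x : x \in V -> R (f a) x || R (f b) x.
  by move=> /(subsetP subV) /imsetP[z _ ->].
have [k hk] := ht5 mV (minimal_set_trace mV).
have [hR hsurj _] := hk.
have [x1 x1V hx1] := hsurj true; have [x0 x0V hx0] := hsurj false.
have R01 : R x1 x0 = false by rewrite hR // hx1 hx0.
have mk c d : R c x0 -> R d x1 -> edge c d.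
  move=> c0 d1; split; try exact: class_of_in.
  exists V, k; split=> //; apply/setP => x; rewrite !inE andbC.
    case xV: (x \in V) => //=.
    by rewrite (Req _ c0) hR // hx0 eq_sym eqbF_neg.
  case xV: (x \in V) => //=.
  by rewrite (Req _ d1) hR // hx1; case: (k x).
case/orP: (rV _ x0V) => f0; case/orP: (rV _ x1V) => f1.
- by move: R01; rewrite -(Req _ f1) f0.
- exact: mk.
(* With the reversed orientation, [f] after [e] would send [a] to the top and [b] to the bottom,
   against [edge_monotone]. *)
- have hba := mk _ _ f0 f1.
  have := @edge_monotone _ _ _ _ _ hba hab hfe.
  move/(_ (fun x => etrans (orbC _ _) (rfe x))).
  rewrite -(Reqr _ (fR _ _ ea)) -(Reqr _ (fR _ _ eb)) Rxx (negPf nRf).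
  by move/(_ isT).
- by move: R01; rewrite -(Req _ f1) f0.
Qed.

(** * Compatibility and antisymmetry of the order *)

Definition le x y := class_le w R (class_of R x) (class_of R y).

Lemma le_refl x : le x x. Proof. exact: rt_refl. Qed.

Lemma le_trans y x z : le x y -> le y z -> le x z.
Proof. exact: rt_trans. Qed.

Lemma leR x y : R x y -> le x y.
Proof. by rewrite -class_of_eq /le => /eqP->; apply: rt_refl. Qed.

Lemma edge_le x y : edge x y -> le x y. Proof. by move=> h; apply: rt_step. Qed.

(** Induction on the last step of the closure; intermediate classes are lifted to elements. *)
Lemma le_ind_right x (P : A -> Prop) :
  (forall y, R x y -> P y) ->
  (forall y z, le x y -> P y -> edge y z -> P z) ->
  forall y, le x y -> P y.
Proof.
move=> P0 PS y; rewrite /le /class_le => /(@clos_rt_rtn1 _ _ _ _).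
move eC: (class_of R y) => C hC; elim: hC y eC => [|D E hDE hC IH] y eC.
  by apply: P0; rewrite -class_of_eq eC.
have [/imsetP[z _ eD] _ _] := hDE.
apply: (PS z); last by rewrite /edge eC -eD.
- by rewrite /le -eD; apply: clos_rtn1_rt.
- exact: IH.
Qed.

Lemma le_chain x y : le x y -> exists k (c : nat -> A),
  [/\ R x (c 0), R y (c k) & forall i, i < k -> edge (c i) (c i.+1)].
Proof.
elim/le_ind_right: y / => [y xy|y z _ [k [c [x0 yk hc]]] yz].
  by exists 0, (fun=> x); split; rewrite // Rsym.
exists k.+1, (fun i => if i <= k then c i else z).
rewrite leq0n ltnn; split=> // i; rewrite ltnS => ik; rewrite ik.
case: ltnP => [/hc //|ki].
have -> : i = k by apply/eqP; rewrite eqn_leq ik.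
exact: edge_congr yk (Rxx z) yz.
Qed.

(** A unary polynomial either collapses an edge or carries it to an edge. *)
Lemma le_unary f x y : unary_polynomial w f -> le x y -> le (f x) (f y).
Proof.
move=> hf; elim/le_ind_right: y / => [y xy|y z _ fxy yz].
  exact/leR/(congruence_unary Rcong hf).
apply: le_trans fxy _; case fyz: (R (f y) (f z)); first exact: leR.
by apply/edge_le/edge_image; rewrite ?fyz.
Qed.

Lemma le_polynomial k (p : {ffun 'I_k -> A} -> A) (x y : {ffun 'I_k -> A}) :
  polynomial w p -> (forall i, le (x i) (y i)) -> le (p x) (p y).
Proof.
move=> hp; apply: preorder_compatible hp _ _ => //.
- exact: le_refl.
- by move=> ? ? ?; apply: le_trans.
- by move=> f hf ? ?; apply: le_unary.
Qed.

Lemma le_monotone a b c d f : edge a b -> le c d -> unary_polynomial w f ->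
  (forall x, R a (f x) || R b (f x)) -> R b (f c) -> R b (f d).
Proof.
move=> hab cd hf rf fc; elim/le_ind_right: d / cd => [d cd|y z _ fy yz].
  by rewrite -(Reqr _ (congruence_unary Rcong hf cd)).
exact: edge_monotone hab yz hf rf fy.
Qed.

(** The retraction onto the edge is monotone, so going up from [b] to [a] would force [e a] into the
    class of [b]. *)
Lemma edge_nle a b : edge a b -> ~ le b a.
Proof.
move=> hab hba; have nRab := edge_nR hab.
have [U [h [e [_ hU he eU [ea eb]]]]] := edge_retraction hab.
have re x : R a (e x) || R b (e x).
  by have := hU _ (eU x); case: ifP => _ ->; rewrite ?orbT.
have := le_monotone hab hba he re eb.
by rewrite -(Reqr _ ea) Rsym (negPf nRab).
Qed.

Lemma le_last x y : le x y -> ~~ R x y -> exists2 c, le x c & edge c y.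
Proof.
elim/le_ind_right: y / => [y -> //|y z xy _ yz _].
by exists y.
Qed.

Lemma le_antisym x y : le x y -> le y x -> R x y.
Proof.
move=> xy yx; apply: contrapT => /negP nR.
have [c xc cy] := le_last xy nR.
exact: edge_nle cy (le_trans yx xc).
Qed.

(** * Weak near-unanimity terms *)

Definition single (j : 'I_n) (y x : A) : {ffun 'I_n -> A} :=
  [ffun k => if k == j then y else x].

Lemma single_id j x : single j x x = [ffun=> x].
Proof. by apply/ffunP => k; rewrite !ffunE if_same. Qed.

Definition wnu_term (t : {ffun 'I_n -> A} -> A) :=
  term_operation w t /\ weak_near_unanimity t.

Lemma wnu_single t i j x y : wnu_term t -> t (single i y x) = t (single j y x).
Proof. by move=> [_ [_]]; apply. Qed.

Lemma circ_single t j x y : wnu_term t -> circ t x y = t (single j y x).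
Proof.
move=> ht; have n0 : 0 < n by apply: leq_ltn_trans (ltn_ord j).
by rewrite (wnu_single j (Ordinal n0) x y ht).
Qed.

Lemma wnu_step_term t : wnu_term t -> wnu_term (wnu_step t).
Proof.
move=> [ht [tid tsym]].
have cid x : circ t x x = x.
  rewrite -[RHS]tid; congr t.
  by apply/ffunP => k; rewrite !ffunE if_same.
split; [|split].
- apply: (term_operation_comp (q := fun j x => circ t (t x) (x j))) => // j.
  apply: (term_operation_comp (q := fun k x => if val k == 0 then x j
                                               else t x)) => // k.
  by case: (val k == 0) => //; apply: term_operation_proj.
- move=> x; rewrite /wnu_step tid -[RHS]tid; congr t.
  by apply/ffunP => k; rewrite !ffunE cid.
- move=> x y i j; rewrite /wnu_step (tsym x y i j).
  set u := t [ffun k => if k == j then y else x].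
  (* The inner value [u] no longer depends on the exceptional coordinate, so the outer tuple again
     has a single exceptional coordinate. *)
  have E l : [ffun j0 => circ t u ([ffun k => if k == l then y else x] j0)] =
             single l (circ t u y) (circ t u x).
    by apply/ffunP => k; rewrite !ffunE; case: ifP.
  by rewrite !E; apply: tsym.
Qed.

(** An idempotent unary operation is the identity, and a nullary one is a constant. *)
Lemma term_degenerate (V : Type) (t : term n V) : weak_near_unanimity w ->
  n <= 1 -> (exists v, forall rho, eval w rho t = rho v) \/
            (exists c, forall rho, eval w rho t = c).
Proof.
move=> [wid _] n1; elim: t => [v|s IH]; first by left; exists v.
case n0: (0 < n); last first.
  have none (i : 'I_n) : False.
    by have := leq_ltn_trans (leq0n i) (ltn_ord i); rewrite n0.
  right; exists (w [ffun i => False_rect _ (none i)]) => rho /=; congr w.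
  by apply/ffunP => i; case: (none i).
pose i0 := Ordinal n0.
have E rho : eval w rho (App s) = eval w rho (s i0).
  rewrite /= -[RHS]wid; congr w; apply/ffunP => i; rewrite !ffunE.
  congr (eval w rho (s _)); apply: val_inj => /=.
  by apply/eqP; rewrite -leqn0 -ltnS; apply: leq_trans n1.
case: (IH i0) => [[v hv]|[c hc]].
  by left; exists v => rho; rewrite E.
by right; exists c => rho; rewrite E.
Qed.

(** The meet on an edge depends on two arguments, so it is neither a projection nor a constant. *)
Lemma edge_arity a b : weak_near_unanimity w -> edge a b -> 1 < n.
Proof.
move=> hw hab; rewrite ltnNge; apply/negP => n1.
have [m [[t mt] _ mE]] := edge_meet hab.
case: (term_degenerate t hw n1) => [[[i|c] hv]|[c hv]].
- have := mE [ffun k => k == i]; rewrite mt hv /= !ffunE eqxx Rxx /meet2 !ffunE.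
  by case: i {hv} => [[|[|]]].
- by move: (mE [ffun=> true]) (mE [ffun=> false]); rewrite !mt !hv /= => ->;
    rewrite /meet2 !ffunE.
- by move: (mE [ffun=> true]) (mE [ffun=> false]); rewrite !mt !hv /= => ->;
    rewrite /meet2 !ffunE.
Qed.

Lemma unary_polynomial_single t j x : wnu_term t ->
  unary_polynomial w (fun s => t (single j s x)).
Proof.
move=> [/polynomial_term ht _].
apply: (unary_polynomial_of (q := fun k s => if k == j then s else x)) => // k.
by case: (k == j); [apply: unary_polynomial_id | apply: unary_polynomial_const].
Qed.

Lemma le_single t j x x' y y' : wnu_term t -> le x x' -> le y y' ->
  le (t (single j y x)) (t (single j y' x')).
Proof.
move=> [/polynomial_term ht _] hx hy; apply: le_polynomial => // k.
by rewrite !ffunE; case: ifP.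
Qed.

Lemma wnu_id t x : wnu_term t -> t [ffun=> x] = x.
Proof. by move=> [_ []]. Qed.

Lemma edge_projection a b : edge a b -> exists e,
  [/\ unary_polynomial w e, forall x, R a (e x) || R b (e x),
      R a (e a) & R b (e b)].
Proof.
move=> /edge_retraction[U [h [e [_ hU he eU [ea eb]]]]]; exists e; split=> // x.
by have := hU _ (eU x); case: ifP => _ ->; rewrite ?orbT.
Qed.

(* If the value moved up along an edge, then the polynomial below would induce
   a join: of two coordinates of [t] for chains of length one, and of the
   first and the last edge of the chain for longer ones. *)
Lemma chain_absorption t : wnu_term t -> 1 < n ->
  forall k (c : nat -> A), (forall i, i < k -> edge (c i) (c i.+1)) ->
  forall j, R (c 0) (t (single j (c k) (c 0))).
Proof.
move=> ht n1 k; elim/ltn_ind: k => -[|[|k]] IH c hc j.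
- by rewrite single_id wnu_id.
- set a := c 0; set b := c 1; have hab : edge a b by apply: hc.
  set v := t _; apply: contrapT => /negP nR.
  have hav : edge a v.
    have := edge_image hab (unary_polynomial_single j a ht).
    by rewrite single_id wnu_id //; apply.
  have [e [he re ea ev]] := edge_projection hav.
  have [j' jj'] : exists j' : 'I_n, j' != j.
    have n0 := ltnW n1.
    case: (eqVneq (Ordinal n0) j) => [<-|]; last by exists (Ordinal n0).
    by exists (Ordinal n1).
  have hP : polynomial w (fun x => e (t x)).
    by apply: polynomial_unary_comp => //; apply: polynomial_term; case: ht.
  have := edge_meet_preserving hav (fun=> hab) hP (fun x => re _)
    [ffun i => i == j] [ffun i => i == j'].
  have E i : choices (fun=> a) (fun=> b) [ffun l => l == i] = single i b a.
    by apply/ffunP => l; rewrite !ffunE.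
  have -> : choices (fun=> a) (fun=> b)
      [ffun i => [ffun i0 => i0 == j] i && [ffun i0 => i0 == j'] i] = [ffun=> a].
    apply/ffunP => l; rewrite !ffunE; case: eqP => [->|//] /=.
    by rewrite eq_sym (negPf jj').
  rewrite !E (wnu_single j' j a b ht) -/v ev wnu_id //= -(Reqr _ ea) Rsym.
  by rewrite (negPf nR).
- set a := c 0; set b := c k.+2; pose d := c k.+1; pose a' := c 1.
  have haa' : edge a a' by apply: hc.
  have hdb : edge d b by apply: hc.
  (* Induction is used on the chain without its last edge, without both end edges, and without its
     first edge. *)
  have Rad : R a (t (single j d a)).
    by apply: (IH k.+1) => // i ik; apply: hc; apply: ltnW.
  have Ra'd : R a' (t (single j d a')).
    apply: (IH k _ (fun i => c i.+1)) => [|i ik]; first exact: leqnSn.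
    by apply: hc; rewrite !ltnS ltnW.
  have Ra'b : R a' (t (single j b a')).
    by apply: (IH k.+1 _ (fun i => c i.+1)) => // i ik; apply: hc.
  set v := t _; apply: contrapT => /negP nR.
  have hav : edge a v.
    apply: (@edge_congr (t (single j d a)) _ v); rewrite 1?Rsym //.
    apply: (edge_image hdb (unary_polynomial_single j a ht)).
    by rewrite -(Req _ Rad).
  have [e [he re ea ev]] := edge_projection hav.
  have eR x y : R x y -> R (e x) (e y) by apply: (congruence_unary Rcong he).
  (* Raising [a] to [a'] gives [v] below [a'], and [e] is monotone into its edge. *)
  have ea' : R v (e a').
    apply: le_monotone hav _ he re ev.
    apply: (@le_trans (t (single j b a'))); last by apply: leR; rewrite Rsym.
    by apply: le_single => //; [apply: edge_le | apply: le_refl].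
  pose P (x : {ffun 'I_2 -> A}) := e (t (single j (x ord_max) (x ord0))).
  have hP : polynomial w P.
    apply: polynomial_unary_comp => //.
    apply: (polynomial_comp (q := fun k x => if k == j then x ord_max
                                             else x ord0)) => [|i].
      by apply: polynomial_term; case: ht.
    by case: (i == j); apply: polynomial_proj.
  (* On these two edges [P] takes the value [a] at the bottom pair and [v] as soon as one argument
     is raised: a join. *)
  have hcd (i : 'I_2) : edge (if i == ord0 then a else d)
                             (if i == ord0 then a' else b).
    by case: ifP.
  have := edge_meet_preserving hav hcd hP (fun x => re _)
    [ffun i => i == ord0] [ffun i => i != ord0].
  rewrite /P !ffunE /= -/v ev -(Reqr _ (eR _ _ Ra'd)) ea'.
  by rewrite -(Reqr _ (eR _ _ Rad)) -(Reqr _ ea) Rsym (negPf nR).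
Qed.

Lemma le_absorption t x y j : wnu_term t -> 1 < n -> le x y ->
  R x (t (single j y x)).
Proof.
move=> ht n1 /le_chain[k [c [x0 yk hc]]].
rewrite (Req _ x0); apply: Rtrans (chain_absorption ht n1 hc j) _.
apply: (congruence_polynomial Rcong) => [|i].
  by apply: polynomial_term; case: ht.
by rewrite !ffunE Rsym; case: ifP.
Qed.

(** Otherwise, by symmetry, any one coordinate could be lowered without leaving the class of [y];
    meet preservation would then allow lowering all of them, against idempotence. *)
Lemma edge_strict t x y j : wnu_term t -> edge x y -> ~~ R y (t (single j x y)).
Proof.
move=> ht hxy; apply/negP => Ry.
have [e [he re ex ey]] := edge_projection hxy.
have eR a b : R a b -> R (e a) (e b) by apply: (congruence_unary Rcong he).
have hP : polynomial w (fun x => e (t x)).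
  by apply: polynomial_unary_comp => //; apply: polynomial_term; case: ht.
have := edge_meet_preserving hxy (fun=> hxy) hP (fun x => re _).
set ch := choices _ _ => hmeet.
(* The first [m] coordinates have been lowered to [x]. *)
have hm m : m <= n -> R y (e (t (ch [ffun i : 'I_n => ~~ (i < m)]))).
  elim: m => [_|m IH mn].
    have -> : ch [ffun i : 'I_n => ~~ (i < 0)] = [ffun=> y].
      by apply/ffunP => i; rewrite !ffunE.
    by rewrite wnu_id.
  pose l := Ordinal mn.
  have -> : [ffun i : 'I_n => ~~ (i < m.+1)] =
      [ffun i => [ffun i : 'I_n => ~~ (i < m)] i && [ffun i => i != l] i].
    apply/ffunP => i; rewrite !ffunE ltnS leq_eqVlt negb_or andbC.
    by congr (_ && _).
  rewrite hmeet IH 1?ltnW //=.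
  have -> : ch [ffun i => i != l] = single l x y.
    by apply/ffunP => i; rewrite !ffunE; case: eqP.
  by rewrite (wnu_single l j y x ht) -(Reqr _ (eR _ _ Ry)).
have := hm n (leqnn n).
have -> : ch [ffun i : 'I_n => ~~ (i < n)] = [ffun=> x].
  by apply/ffunP => i; rewrite !ffunE ltn_ord.
rewrite wnu_id // -(Reqr _ ex) Rsym.
by rewrite (negPf (edge_nR hxy)).
Qed.

Lemma le_single_below t x y j : wnu_term t -> le x y -> le (t (single j x y)) y.
Proof.
move=> ht xy; rewrite -{2}[y](wnu_id y ht) -(single_id j).
by apply: le_single => //; apply: le_refl.
Qed.

(** Raising [x] to the lower end of the last edge below [y] only increases the value, so
    [edge_strict] suffices. *)
Lemma le_strict t x y j : wnu_term t -> le x y -> ~~ R x y ->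
  ~~ R (t (single j x y)) y.
Proof.
move=> ht xy nR; have [c xc cy] := le_last xy nR.
apply/negP => Rty; have /negP := edge_strict j ht cy; apply.
apply: le_antisym; last exact/le_single_below/edge_le.
apply: (@le_trans (t (single j x y))); first by apply: leR; rewrite Rsym.
by apply: le_single => //; apply: le_refl.
Qed.

(** * Iterates and meets under a largest class *)

Section Top.
Variable T : A.
Hypothesis leT : forall x, le x T.

Lemma le_single_top t x j : wnu_term t -> le x (t (single j x T)).
Proof.
move=> ht; rewrite -{1}[x](wnu_id x ht) -(single_id j).
by apply: le_single => //; apply: le_refl.
Qed.

(** By absorption [circ t u T] is [u] modulo [R], so the new value is [t] with [v] in one place and
    [u] elsewhere. Strictness is applied once to get [v] below [u], and again for the new value. *)
Lemma wnu_step_top t x j : wnu_term t -> 1 < n ->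
  let u := t (single j x T) in let u' := wnu_step t (single j x T) in
  le u' u /\ (~~ R x u -> ~~ R u' u).
Proof.
move=> ht n1 u u'; pose v := t (single j x u).
have xu : le x u by apply: le_single_top.
have vu : le v u by apply: le_single_below.
have Ru' : R u' (t (single j v u)).
  apply: (congruence_polynomial Rcong (p := t)) => [|k].
    by apply: polynomial_term; case: ht.
  rewrite !ffunE -/u (circ_single j) //; case: ifP => // _.
  by rewrite Rsym; apply: le_absorption.
split; first by apply: le_trans (leR Ru') _; apply: le_single_below.
by move=> nR; rewrite (Req _ Ru'); do 2!apply: le_strict => //.
Qed.

Lemma wnu_iter_term i : weak_near_unanimity w -> wnu_term (wnu_iter w i).
Proof.
move=> hw; rewrite /wnu_iter; elim: i.-1 => [|k IH] /=.
  by split=> //; apply: term_operation_self.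
exact: wnu_step_term.
Qed.

(* Until it reaches [x], each iteration strictly lowers the value. *)
Lemma wnu_iter_top x j : weak_near_unanimity w -> 1 < n ->
  R x (wnu_iter w #|A| (single j x T)).
Proof.
move=> hw n1.
pose u k := wnu_iter w k.+1 (single j x T).
pose D y := [set z | `[< le z y >]].
have xu k : le x (u k) by apply/le_single_top/wnu_iter_term.
(* Every strict descent removes at least one element from the down-set. *)
have H k : R x (u k) \/ #|D (u k)| + k <= #|A|.
  elim: k => [|k IH]; first by right; rewrite addn0 max_card.
  have [uu nRu] := wnu_step_top x j (wnu_iter_term k.+1 hw) n1.
  rewrite -/(u k) in uu nRu; rewrite -/(u k.+1) in uu nRu.
  case Rx: (R x (u k)).
    left; apply: le_antisym => //; apply: le_trans uu _.
    by apply: leR; rewrite Rsym.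
  right; case: IH => [|IH]; first by rewrite Rx.
  apply: leq_trans IH; rewrite addnS -addSn leq_add2r; apply: proper_card.
  apply/properP; split.
    apply/subsetP => z; rewrite !inE => /asboolP zu; apply/asboolP.
    exact: le_trans zu uu.
  exists (u k); rewrite inE; first exact/asboolP/le_refl.
  apply/asboolP => uu'; move/negP: (nRu (negbT Rx)); apply.
  exact: le_antisym.
have A0 : 0 < #|A| by apply/card_gt0P; exists x.
suff : R x (u #|A|.-1) by rewrite /u prednK.
(* The sequence [u] starts at the first iterate, hence the predecessor. At this index the down-set
   has at most one element, yet contains both [x] and the iterate. *)
case: (H #|A|.-1) => //; rewrite -[X in _ <= X](prednK A0) -add1n leq_add2r.
move/card_le1_eqP => /(_ x (u #|A|.-1)); rewrite !inE => <- //.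
- exact/asboolP.
- exact/asboolP/le_refl.
Qed.

(** Raising all other arguments to [T] reduces this to [wnu_iter_top]. *)
Lemma wnu_iter_le_arg (x : {ffun 'I_n -> A}) i : weak_near_unanimity w ->
  1 < n -> le (wnu_iter w #|A| x) (x i).
Proof.
move=> hw n1; have ht := wnu_iter_term #|A| hw.
apply: (@le_trans (wnu_iter w #|A| (single i (x i) T))); last first.
  by apply: leR; rewrite Rsym wnu_iter_top.
apply: le_polynomial => [|k]; first by apply: polynomial_term; case: ht.
by rewrite ffunE; case: eqP => [->|_]; [apply: le_refl | apply: leT].
Qed.

Lemma wnu_iter_glb (x : {ffun 'I_n -> A}) z : weak_near_unanimity w ->
  (forall i, le z (x i)) -> le z (wnu_iter w #|A| x).
Proof.
move=> hw hz; have ht := wnu_iter_term #|A| hw.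
rewrite -[z](wnu_id z ht); apply: le_polynomial => [|k].
  by apply: polynomial_term; case: ht.
by rewrite ffunE.
Qed.

Lemma wnu_iter_is_meet (x : {ffun 'I_n -> A}) : weak_near_unanimity w -> 1 < n ->
  is_meet w R [set class_of R (x i) | i : 'I_n]
    (class_of R (wnu_iter w #|A| x)).
Proof.
move=> hw n1; split; first exact: class_of_in.
  by move=> _ /imsetP[i _ ->]; apply: wnu_iter_le_arg.
move=> _ /imsetP[z _ ->] hz; apply: wnu_iter_glb => // i.
exact/hz/imset_f.
Qed.

End Top.

(** As [R] is not total, some class lies strictly below that of [T], which yields an edge. *)
Lemma top_arity T : weak_near_unanimity w -> (forall x, le x T) -> 1 < n.
Proof.
move=> hw leT; have [_ _ _ nsub _] := hcov.
case: (pselect (forall x, R x T)) => [RT|/existsNP[x /negP nR]].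
  by case: nsub => x y _; rewrite (Req _ (RT x)) Rsym.
have [c _ cT] := le_last (leT x) nR.
exact: edge_arity hw cT.
Qed.

End Edges.

Theorem theorem3p8 (A : finType) (n : nat) (w : {ffun 'I_n -> A} -> A)
  (R : rel A)
  (hw : weak_near_unanimity w)
  (habelian : abelian_congruence w R)
  (hcovers : con_covers w R (@con1 A))
  (htype : has_type5 w R (@con1 A))
  (hlargest : has_largest_class w R) :
  [/\ forall C1 C2 : {set A}, C1 \in classes R -> C2 \in classes R ->
        exists M, is_meet w R [set C1; C2] M,
      forall x : {ffun 'I_n -> A},
        exists2 M, is_meet w R [set class_of R (x i) | i : 'I_n] M
                 & wnu_iter w #|A| x \in M
    & R =2 @con0 A ->
        exists2 s : {ffun 'I_2 -> A} -> A,
          term_operation w s & semilattice_operation (apply2 s)].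
Proof.
have [_ /imsetP[T _ ->] hT] := hlargest.
have leT x : le w R x T by apply/hT/class_of_in.
have n1 := top_arity hcovers hw leT.
pose j0 := Ordinal (ltnW n1); pose j1 := Ordinal n1.
have j10 : j1 == j0 = false by [].
have [[eqR _] _ _ _ _] := hcovers.
split.
- move=> _ _ /imsetP[x _ ->] /imsetP[y _ ->].
  exists (class_of R (wnu_iter w #|A| (single j0 x y))).
  (* Since [1 < n], both [x] and [y] occur in the tuple. *)
  suff -> : [set class_of R x; class_of R y] =
            [set class_of R (single j0 x y i) | i : 'I_n].
    exact: wnu_iter_is_meet leT _ _ _.
  apply/setP => C; rewrite !inE; apply/orP/imsetP.
    by case=> /eqP->; [exists j0 | exists j1]; rewrite // ffunE ?eqxx ?j10.
  by case=> i _ ->; rewrite ffunE; case: ifP; [left|right].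
- move=> x; exists (class_of R (wnu_iter w #|A| x)).
    exact: wnu_iter_is_meet leT _ _ _.
  by rewrite inE; case: (eqR T T (wnu_iter w #|A| x)).
- move=> R0; pose m x y := wnu_iter w #|A| (single j0 x y).
  have lel x y : le w R (m x y) x.
    have := wnu_iter_le_arg hcovers htype leT (single j0 x y) j0 hw n1.
    by rewrite ffunE eqxx.
  have ler x y : le w R (m x y) y.
    have := wnu_iter_le_arg hcovers htype leT (single j0 x y) j1 hw n1.
    by rewrite ffunE j10.
  have leg x y z : le w R z x -> le w R z y -> le w R z (m x y).
    move=> zx zy; apply: wnu_iter_glb => // i.
    by rewrite ffunE; case: ifP.
  (* Classes are now singletons, so [m] is the binary meet of a partial order on [A], and the
     semilattice laws follow from antisymmetry. *)
  have anti x y : le w R x y -> le w R y x -> x = y.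
    move=> xy yx; have := le_antisym hcovers xy yx.
    by rewrite R0 => /eqP.
  exists (fun v => wnu_iter w #|A| (single j0 (v ord0) (v ord_max))).
    have [ht _] := wnu_iter_term #|A| hw.
    apply: (term_operation_comp (q := fun k v => if k == j0 then v ord0
                                                 else v ord_max)) => // k.
    by case: (k == j0); apply: term_operation_proj.
  have E x y : apply2 (fun v => wnu_iter w #|A| (single j0 (v ord0) (v ord_max)))
                 x y = m x y by rewrite /apply2 !ffunE.
  split=> [x|x y|x y z]; rewrite !E.
  + by apply: anti; [apply: lel | apply: leg; apply: le_refl].
  + by apply: anti; apply: leg.
  + apply: anti; apply: (leg).
    * apply: leg; [exact: lel | exact: le_trans (ler _ _) (lel _ _)].
    * exact: le_trans (ler _ _) (ler _ _).
    * exact: le_trans (lel _ _) (lel _ _).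
    * apply: leg; [exact: le_trans (lel _ _) (ler _ _) | exact: ler].
Qed.
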